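(* Let $N\in\mathbb N$ and $C=2\sqrt N$. (1) Let $X_1,X_2,X_3,X_4$ be self-adjoint $N\times N$ complex matrices with all eigenvalues in $(-\pi,\pi]$, let $x^j_\alpha=\mathrm{Tr}(X_j\theta_\alpha)$ for $1\le\alpha\le N^2$, $x^j=(x^j_1,\dots,x^j_{N^2})$, and let $\lambda_j=(\lambda_{j,1},\dots,\lambda_{j,N})$ be the angular eigenvalues of $e^{iX_j}$. If $U_p=e^{iX_1}e^{iX_2}e^{iX_3}e^{iX_4}$, then $$\mathcal A_p=\|U_p-1\|_{H-S}^2\;\le\; C^2\sum_{1\le j\le 4}|x^j|^2\;=\;C^2\sum_{1\le j\le 4}|\lambda_j|^2 .$$ If only $m\in\{1,2,3\}$ of the four bond variables of the plaquette are retained (the remaining ones being set equal to the identity), then the same bound holds with the sum over $j$ running only over the $m$ retained bond variables and with the numerical factor $4$ in $C^2=4N$ replaced by $m$. (2) Let $d\in\{2,3,4\}$, $L\in\mathbb N$, and let $B$ denote either free or periodic boundary conditions. Let the gauge bond variables of the lattice $\Lambda$ be fixed in the enhanced temporal gauge, and for each retained bond $b$ write its bond variable as $U_b=e^{iX_b}$ with $X_b$ self-adjoint with eigenvalues in $(-\pi,\pi]$, $x^b_\alpha=\mathrm{Tr}(X_b\theta_\alpha)$, and $\lambda_b\in(-\pi,\pi]^N$ the vector of angular eigenvalues of $U_b$. Then the total action $A^B=\sum_p\mathcal A_p$ satisfies $$A^B\;\le\;2(d-1)\,C^2\sum_b|x^b|^2\;=\;2(d-1)\,C^2\sum_b|\lambda_b|^2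 ,$$ where the sums run over all retained bonds $b$.
   Context: Norms and coordinates. For an $N\times N$ matrix $M$, $\|M\|_{H-S}=[\mathrm{Tr}(M^\dagger M)]^{1/2}$. The matrices $\theta_\alpha$, $1\le\alpha\le N^2$, form a basis of the real vector space of self-adjoint $N\times N$ matrices with $\mathrm{Tr}\,\theta_\alpha\theta_\beta=\delta_{\alpha\beta}$. $|\cdot|$ is the Euclidean norm. Angular eigenvalues: for $U\in\mathrm U(N)$ with eigenvalues $e^{i\lambda_1},\dots,e^{i\lambda_N}$, $\lambda_k\in(-\pi,\pi]$, the $\lambda_k$ are the angular eigenvalues of $U$. Every $U\in \mathrm U(N)$ is $e^{iX}$ with $X$ self-adjoint with eigenvalues $\lambda_1,\dots,\lambda_N$, and then $|x|^2=\mathrm{Tr}X^2=\sum_k\lambda_k^2$. Lattice. $\Lambda\subset a\mathbb Z^d$, $a\in(0,1]$, is a finite hypercubic lattice with $L$ sites on each side; the sites in each coordinate $x^\mu$, $\mu=0,\dots,d-1$, are labelled $1,\dots,L$; $x^0$ is the time direction; $e^\mu$ is the unit vector in direction $\mu$. Free bonds: $b_\mu(x)$ from $x\in\Lambda$ to $x+ae^\mu\in\Lambda$. Periodic bonds: the free bonds plus, in each coordinate direction $\mu$, the extra bonds from each site with $x^\mu=L$ to the site with $x^\mu=1$ (other coordinates equal). Free plaquettes: $p_{\mu\nu}(x)$, $\mu<\nu$, with vertices $x,x+ae^\mu,x+ae^\mu+ae^\nu,x+ae^\nu\in\Lambda$. Periodic plaquettes: all plaquettes $p_{\mu\nu}(x)$,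 $x\in\Lambda$, $\mu<\nu$, formed from periodic bonds (addition understood periodically). Each bond $b$ carries a variable $U_b\in \mathrm U(N)$. For $p=p_{\mu\nu}(x)$, $U_p=U_{b_\mu(x)}U_{b_\nu(x+ae^\mu)}U_{b_\mu(x+ae^\nu)}^{\dagger}U_{b_\nu(x)}^{\dagger}$ and $\mathcal A_p=\|U_p-1\|_{H-S}^2=2\,\mathrm{Re}\,\mathrm{Tr}(1-U_p)$. $A^B=\sum_p\mathcal A_p$, the sum being over free (respectively periodic) plaquettes. Enhanced temporal gauge: the following bond variables are set equal to the identity: all free bonds in the time direction $0$; for $d\ge2$ the free bonds in direction $1$ with $x^0=1$; for $d\ge3$ also the free bonds in direction $2$ with $x^0=1,x^1=1$; for $d=4$ also the free bonds in direction $3$ with $x^0=x^1=x^2=1$. All other bonds (including all extra bonds in the periodic case) are called retained. The number of retained bonds is $\Lambda_r$ for free boundary conditions and $\Lambda_r+\Lambda_e$ for periodic ones, where $\Lambda_e=dL^{d-1}$ and $\Lambda_r=(L-1)^2$, $(2L+1)(L-1)^2$, $(3L^3-L^2-L-1)(L-1)$ for $d=2,3,4$ respectively. *)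

(* Defs.v *)
(* MathComp / MathComp-Analysis; complex numbers are R[i] of real-closed. *)
From mathcomp Require Import all_boot all_order all_algebra.
From mathcomp Require Import all_classical all_reals all_analysis.
From mathcomp Require Import complex.

Set Implicit Arguments.
Unset Strict Implicit.
Unset Printing Implicit Defensive.

Import Order.TTheory GRing.Theory Num.Theory.
Import numFieldNormedType.Exports.

Local Open Scope ring_scope.
Local Open Scope complex_scope.
Local Open Scope sesquilinear_scope.

Section Matrices.
Context {R : realType} {N : nat}.
Implicit Types (X U M : 'M[R[i]]_N) (theta : 'I_(N ^ 2) -> 'M[R[i]]_N).

(* The alias R[i]^o carries the topology of the modulus on complex numbers. *)
Definition expmx M : 'M[R[i]]_N :=
  limn (series (fun k : nat => k`!%:R^-1 *: M ^+ k) : nat -> 'M[(R[i])^o]_N).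

Definition expimx X : 'M[R[i]]_N := expmx ('i%C *: X).

(* The trace of M^dagger M is a nonnegative real, so Re discards nothing. *)
Definition HSnorm M : R := Num.sqrt (complex.Re (\tr (M ^t* *m M))).

Definition plaq_action U : R := HSnorm (U - 1%:M) ^+ 2.

Definition euclid_norm {n : nat} (v : 'rV[R]_n) : R :=
  Num.sqrt (\sum_k v 0 k ^+ 2).

(* In the last clause, uniqueness of the real coefficients is linear
   independence over the reals. *)
Definition orthonormal_sa_basis theta : Prop :=
  [/\ forall a, theta a \is hermsymmx,
      forall a b, \tr (theta a *m theta b) = (a == b)%:R
    & forall X, X \is hermsymmx ->
        exists! c : 'rV[R]_(N ^ 2), X = \sum_a (c 0 a)%:C *: theta a].

(* The trace of a product of two self-adjoint matrices is real, so for
   self-adjoint X and theta a, Re discards nothing. *)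
Definition coords theta X : 'rV[R]_(N ^ 2) :=
  \row_a complex.Re (\tr (X *m theta a)).

(* The order of R[i] only compares numbers with equal imaginary parts: the
   condition says that z is real and belongs to ]-pi, pi]. *)
Definition eigenvalues_in_range X : Prop :=
  forall z : R[i], eigenvalue X z -> - (pi : R)%:C < z <= (pi : R)%:C.

Definition expi (t : R) : R[i] := cos t +i* sin t.

(* The eigenvalues are listed with algebraic multiplicity, in any order. *)
Definition angular_eigenvalues U (lam : 'rV[R]_N) : Prop :=
  (forall k, - pi < lam 0 k <= pi) /\
  char_poly U = \prod_k ('X - (expi (lam 0 k))%:P).

End Matrices.

(* Sites are represented by their coordinate labels, shifted to 0, ..., L-1;
   the lattice spacing plays no role in the bond and plaquette structure. *)
Notation site d L := {ffun 'I_d -> 'I_L}.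

(* (x, mu) is the bond leaving x in direction mu; it is an extra bond when
   x mu is the last label. *)
Notation bond d L := (site d L * 'I_d)%type.

(* (x, (mu, nu)); plaquettes are those with mu < nu. *)
Notation plaquette d L := (site d L * ('I_d * 'I_d))%type.

Inductive boundary := Free | Periodic.

Section Lattice.
Context {d L : nat}.
Implicit Types (x : site d L) (b : bond d L) (p : plaquette d L).

(* ordS is the cyclic successor; on free bonds it is the ordinary one. *)
Definition step x (mu : 'I_d) : site d L :=
  [ffun nu => if nu == mu then ordS (x nu) else x nu].

Definition free_bond b : bool := ((b.1 b.2).+1 < L)%N.

Definition bond_in (B : boundary) b : bool :=
  if B is Free then free_bond b else true.

Definition free_plaq p : bool :=
  ((p.1 p.2.1).+1 < L)%N && ((p.1 p.2.2).+1 < L)%N.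

Definition plaq_in (B : boundary) p : bool :=
  (p.2.1 < p.2.2)%N && (if B is Free then free_plaq p else true).

(* Enhanced temporal gauge: a free bond of direction mu is set to the identity
   when all coordinates before mu carry the first label. *)
Definition gauge_fixed b : bool :=
  free_bond b && [forall nu : 'I_d, (nu < b.2)%N ==> (b.1 nu == 0 :> nat)].

Definition retained (B : boundary) b : bool := bond_in B b && ~~ gauge_fixed b.

Context {R : realType} {N : nat}.
Implicit Types U : bond d L -> 'M[R[i]]_N.

Definition plaq_var U p : 'M[R[i]]_N :=
  let: (x, (mu, nu)) := p in
  U (x, mu) *m U (step x mu, nu) *m (U (step x nu, mu)) ^t* *m (U (x, nu)) ^t*.

Definition total_action (B : boundary) U : R :=
  \sum_(p : plaquette d L | plaq_in B p) plaq_action (plaq_var U p).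

End Lattice.

(* Main.v *)
(* Telescoping [U1 U2 U3 U4 - 1 = sum_j U1 .. U(j-1) (Uj - 1)], unitary invariance
   of the Hilbert-Schmidt norm and Cauchy-Schwarz bound the action of a plaquette
   by (number of non-identity factors) * sum_j |Uj - 1|^2.  Diagonalizing
   X = P^* diag(l) P gives |exp(iX) - 1|^2 = sum_k |exp(i l_k) - 1|^2 <= sum_k l_k^2
   = Tr X^2 = |x|^2.  For the total action, every bond is a side of at most
   2 (d - 1) plaquettes. *)
Require Import Defs.
From mathcomp Require Import all_boot all_order all_algebra.
From mathcomp Require Import all_classical all_reals all_analysis.
From mathcomp Require Import complex.
From mathcomp Require Import ring lra.

Set Implicit Arguments.
Unset Strict Implicit.
Unset Printing Implicit Defensive.

Import Order.TTheory GRing.Theory Num.Theory.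
Import numFieldNormedType.Exports.

Local Open Scope ring_scope.

(** * Cauchy-Schwarz for finite sums, and telescoping of products *)

Lemma sum_sqr_le (R : realDomainType) (I : finType) (A : {set I}) (a : I -> R) :
  (\sum_(i in A) a i) ^+ 2 <= #|A|%:R * \sum_(i in A) a i ^+ 2.
Proof.
(* Over all ordered pairs, the squared differences add up to twice the gap between the two sides. *)
have h : 0 <= \sum_(i in A) \sum_(j in A) (a i - a j) ^+ 2.
  by do 2 (apply: sumr_ge0 => ? _); exact: sqr_ge0.
have e : \sum_(i in A) \sum_(j in A) (a i - a j) ^+ 2 =
  (#|A|%:R * \sum_(i in A) a i ^+ 2 - (\sum_(i in A) a i) ^+ 2) *+ 2.
  under eq_bigr => i _ do under eq_bigr => j _ do rewrite sqrrB addrAC.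
  under eq_bigr => i _ do rewrite sumrB big_split /= sumr_const sumrMnl -mulr_sumr.
  rewrite sumrB big_split /= sumr_const !sumrMnl -mulr_suml.
  by rewrite expr2 -[in LHS]mulr_natl mulrnBl mulr2n.
by move: h; rewrite e pmulrn_lge0 // subr_ge0.
Qed.

(** Induction splits off the last factor by x y - 1 = (x - 1) + x (y - 1), which keeps the order of
    the factors. *)
Lemma prod_sub1 (T : pzRingType) n (F : nat -> T) :
  \prod_(i < n) F i - 1 = \sum_(i < n) (\prod_(k < i) F k) * (F i - 1).
Proof.
elim: n => [|n IHn]; first by rewrite !big_ord0 subrr.
by rewrite !big_ord_recr /= -IHn mulrBr mulr1 addrC subrKA.
Qed.

Lemma unitarymx1 (C : numClosedFieldType) n : (1%:M : 'M[C]_n) \is unitarymx.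
Proof. by apply/unitarymxP; rewrite trmx1 map_mx1 mulmx1. Qed.

(** * The Hilbert-Schmidt norm and the action of a product of unitaries *)

Section HilbertSchmidt.
Local Open Scope sesquilinear_scope.
Context {R : realType} {N : nat}.
Implicit Types (M U : 'M[R[i]]_N).

Lemma Re_conjM (z : R[i]) :
  complex.Re (Num.conj z * z) = complex.Re z ^+ 2 + complex.Im z ^+ 2.
Proof. by case: z => a b /=; rewrite mulNr opprK !expr2. Qed.

(** This form reduces inequalities between norms to inequalities between real sums of squares. *)
Lemma Re_mxtrace_mulCt M : complex.Re (\tr (M^t* *m M)) =
  \sum_i \sum_j (complex.Re (M i j) ^+ 2 + complex.Im (M i j) ^+ 2).
Proof.
rewrite /mxtrace raddf_sum /= exchange_big /=; apply: eq_bigr => j _.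
rewrite mxE raddf_sum /=; apply: eq_bigr => i _.
by rewrite !mxE; exact: Re_conjM.
Qed.

Lemma HSnorm_sqr M : HSnorm M ^+ 2 = complex.Re (\tr (M^t* *m M)).
Proof.
rewrite sqr_sqrtr // Re_mxtrace_mulCt.
by do 2 (apply: sumr_ge0 => ? _); rewrite addr_ge0 ?sqr_ge0.
Qed.

Lemma HSnorm_sqr_sum M : HSnorm M ^+ 2 =
  \sum_i \sum_j (complex.Re (M i j) ^+ 2 + complex.Im (M i j) ^+ 2).
Proof. by rewrite HSnorm_sqr Re_mxtrace_mulCt. Qed.

Lemma HSnorm_mulUl U M : U \is unitarymx -> HSnorm (U *m M) = HSnorm M.
Proof.
move=> uU; rewrite /HSnorm trmx_mul map_mxM /= !mulmxA mulmxKtV //.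
Qed.

(** Cyclicity of the trace brings [U] next to its adjoint. *)
Lemma HSnorm_mulUr U M : U \is unitarymx -> HSnorm (M *m U) = HSnorm M.
Proof.
move=> uU; rewrite /HSnorm trmx_mul map_mxM /= mxtrace_mulC !mulmxA.
by rewrite mulmxtVK // mxtrace_mulC.
Qed.

(** Cauchy-Schwarz is applied separately to the real and the imaginary part of each entry. *)
Lemma HSnorm_sum (I : finType) (A : {set I}) (F : I -> 'M[R[i]]_N) :
  HSnorm (\sum_(i in A) F i) ^+ 2
    <= #|A|%:R * \sum_(i in A) HSnorm (F i) ^+ 2.
Proof.
rewrite HSnorm_sqr_sum; under [in leRHS]eq_bigr do rewrite HSnorm_sqr_sum.
rewrite [in leRHS]exchange_big mulr_sumr.
apply: ler_sum => i _; rewrite [in leRHS]exchange_big mulr_sumr; apply: ler_sum => j _.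
by rewrite summxE !raddf_sum big_split mulrDr lerD ?sum_sqr_le.
Qed.

Lemma plaq_action_ge0 U : 0 <= plaq_action U.
Proof. exact: sqr_ge0. Qed.

Lemma plaq_action1 : plaq_action (1%:M : 'M[R[i]]_N) = 0.
Proof.
by rewrite /plaq_action subrr /HSnorm mulmx0 mxtrace0 sqrtr0 expr0n.
Qed.

(** Two sides of a plaquette are traversed backwards and enter as adjoints. The adjoint of U - 1 has
    the same entries up to transposition and signs of imaginary parts. *)
Lemma plaq_action_trmxC U : plaq_action (U^t*) = plaq_action U.
Proof.
rewrite /plaq_action [LHS]HSnorm_sqr_sum [RHS]HSnorm_sqr_sum exchange_big.
apply: eq_bigr => i _; apply: eq_bigr => j _; rewrite !mxE eq_sym.
by case: (U i j) => a b; case: (i == j) => /=; rewrite ?mulr1n ?mulr0n /=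
  ?subr0 ?oppr0 ?addr0 sqrrN.
Qed.

Lemma prod_unitarymx (I : Type) (r : seq I) (F : I -> 'M[R[i]]_N) :
  (forall i, F i \is unitarymx) -> \prod_(i <- r) F i \is unitarymx.
Proof.
move=> uF; elim/big_ind: _ => [|x y|i _]; last exact: uF.
  exact: unitarymx1.
exact: mul_unitarymx.
Qed.

(* For [N = 0] both sides vanish, which is why the factor [N] is harmless. *)
Lemma plaq_action_prod n (A : {set 'I_n}) (F : 'I_n -> 'M[R[i]]_N) :
  (forall i, F i \is unitarymx) -> (forall i, i \notin A -> F i = 1%:M) ->
  plaq_action (\prod_i F i)
    <= #|A|%:R * N%:R * \sum_(i in A) plaq_action (F i).
Proof.
move=> uF F1; case: n => [|n] in A F uF F1 *.
  rewrite big_ord0 -idmxE plaq_action1 mulr_ge0 ?ler0n ?mulr_ge0 ?sumr_ge0 //.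
  by move=> i _; exact: plaq_action_ge0.
(* [prod_sub1] wants a family over [nat]; [inord] needs a nonempty index type, whence the separate
   case of no factors. *)
pose G k := F (inord k).
have uG k : G k \is unitarymx by exact: uF.
have GE (i : 'I_n.+1) : G i = F i by rewrite /G inord_val.
have e : \prod_i F i - 1%:M =
    \sum_(i in A) (\prod_(k < i) G k) *m (F i - 1%:M).
  rewrite idmxE; under eq_bigr do rewrite -GE.
  rewrite prod_sub1 big_mkcond [RHS]big_mkcond /=; apply: eq_bigr => i _.
  by case: ifPn => [_|/F1 e]; rewrite GE // e idmxE subrr mulr0.
rewrite /plaq_action e; apply: le_trans (HSnorm_sum _ _) _.
rewrite -mulrA ler_wpM2l ?ler0n // mulr_sumr; apply: ler_sum => i _.
have uP : \prod_(k < i) G k \is unitarymx by apply: prod_unitarymx => k; exact: uG.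
rewrite (HSnorm_mulUl _ uP).
case: (posnP N) => [N0|N_gt0]; last by rewrite ler_peMl ?sqr_ge0 ?ler1n.
rewrite [leLHS]HSnorm_sqr_sum big1; first exact: mulr_ge0 (ler0n _ _) (sqr_ge0 _).
move=> j _.
suff: (j < 0)%N by [].
by rewrite -[X in (_ < X)%N]N0.
Qed.

End HilbertSchmidt.

(** * Entrywise convergence of matrices *)

Section Convergence.
Local Open Scope classical_set_scope.

(** A neighbourhood of a matrix contains a product of neighbourhoods of its entries, and finitely
    many eventual conditions eventually hold together. *)
Lemma cvg_mx (T : topologicalType) m n (F : set_system nat) {FF : Filter F}
    (u : nat -> 'M[T]_(m, n)) (M : 'M[T]_(m, n)) :
  (forall i j, u k i j @[k --> F] --> M i j) -> u @ F --> M.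
Proof.
move=> uM B [P MP PB]; rewrite /nbhs /=.
have : \forall k \near F, forall i j, P i j (u k i j).
  apply: filter_forall => i; apply: filter_forall => j; exact: uM (MP i j).
by apply: filterS => k; exact: PB.
Qed.

End Convergence.

(** * The scalar exponential on the imaginary axis *)

Section Expi.
Local Open Scope complex_scope.
Local Open Scope classical_set_scope.
Context {R : realType}.

Lemma norm_real_complex (x : R) : `|x%:C| = `|x|%:C :> R[i].
Proof. by rewrite normc_def /= expr0n addr0 sqrtr_sqr. Qed.

Lemma cvg_real_complex (u : nat -> R) (a : R) :
  u @ \oo --> a -> ((u k)%:C : R[i]^o) @[k --> \oo] --> (a%:C : R[i]^o).
Proof.
move=> /cvgrPdist_lt ua; apply/cvgrPdist_lt => -[e e'].
(* Positivity in [R[i]] forces the imaginary part [e'] of the radius to vanish. *)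
rewrite ltcE /= => /andP[/eqP -> e0].
have := ua _ e0; apply: filterS => k /= uk.
by rewrite -rmorphB norm_real_complex ltcR.
Qed.

(** Even powers of i are real and give the cosine series; odd ones are imaginary and give the sine
    series. *)
Lemma expi_coeff (t : R) k : k`!%:R^-1 * ('i%C * t%:C) ^+ k =
  (cos_coeff t k)%:C + 'i%C * (sin_coeff t k)%:C :> R[i].
Proof.
have e : 'i%C ^+ k = ((~~ odd k)%:R * (-1) ^+ k./2)%:C
    + 'i%C * ((odd k)%:R * (-1) ^+ k.-1./2)%:C :> R[i].
  rewrite -{1}(odd_double_half k) exprD -mul2n exprM sqr_i.
  case: (boolP (odd k)) => ok; last by rewrite mul0r mulr0 addr0 !mul1r rmorphXn rmorphN1.
  (* [sin_coeff] carries the exponent [k.-1./2], which agrees with [k./2] for odd [k]. *)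
  have -> : k.-1./2 = k./2 by case: k ok => //= k; rewrite uphalf_half => /negbTE ->.
  by rewrite mul0r add0r mul1r expr1 rmorphXn rmorphN1.
rewrite exprMn e mulrDl mulrDr /cos_coeff /sin_coeff /=.
rewrite !(rmorphM, rmorphXn, fmorphV, rmorph_nat) /=; congr (_ + _); ring.
Qed.

Lemma cvg_expi (t : R) :
  ((\sum_(0 <= k < n) k`!%:R^-1 * ('i%C * t%:C) ^+ k : R[i]^o)) @[n --> \oo]
    --> (expi t : R[i]^o).
Proof.
have -> : (fun n => \sum_(0 <= k < n) k`!%:R^-1 * ('i%C * t%:C) ^+ k) =
    (fun n => ((series (cos_coeff t) n)%:C : R[i]^o)) \+
    (fun n => 'i%C * ((series (sin_coeff t) n)%:C : R[i]^o)).
  apply/funext => n /=; under eq_bigr do rewrite expi_coeff.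
  by rewrite big_split -mulr_sumr /= /series /= !raddf_sum.
have -> : expi t = (cos t)%:C + 'i%C * (sin t)%:C.
  by rewrite [LHS]complexE.
apply: cvgD.
  (* Once unlocked, [cos t] is by definition the limit of this series. *)
  by apply: cvg_real_complex; rewrite unlock; exact: is_cvg_series_cos_coeff.
apply: cvgMl_tmp; apply: cvg_real_complex; rewrite unlock.
exact: is_cvg_series_sin_coeff.
Qed.

(** Mean value theorem on [0, x], where the derivative cos is at most 1. *)
Lemma sin_le_id (x : R) : 0 <= x -> sin x <= x.
Proof.
move=> x0; have [|y _] := @MVT_segment R sin cos 0 x x0 (fun y _ => is_derive_sin y).
  exact/continuous_subspaceT/continuous_sin.
by rewrite sin0 !subr0 => ->; rewrite ler_piMl // cos_le1.
Qed.

Lemma sqr_sin_le (x : R) : sin x ^+ 2 <= x ^+ 2.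
Proof.
wlog x0 : x / 0 <= x => [th|].
  case: (leP 0 x) => [/th //|x0].
  by rewrite -sqrrN -sinN -[leRHS]sqrrN th // oppr_ge0 ltW.
(* From 1 on, sin^2 <= 1 is enough; below 1, hence below pi, the sine is nonnegative and [sin_le_id]
   can be squared. *)
have [x1|x1] := leP 1 x.
  rewrite (@le_trans _ _ 1) ?exprn_ege1 // sin2cos2 gerBl sqr_ge0.
rewrite lerXn2r ?nnegrE ?sin_le_id // sin_ge0_pi // x0 /=.
by rewrite (le_trans (ltW x1)) // (le_trans _ (pi_ge2 R)) // ler1n.
Qed.

(** The squared chord is 4 sin^2(t/2) by the half-angle formula, hence at most the squared arc. *)
Lemma expi_sub1_le (t : R) :
  complex.Re (expi t - 1) ^+ 2 + complex.Im (expi t - 1) ^+ 2 <= t ^+ 2.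
Proof.
have := sqr_sin_le (t / 2); have := cos_mulr2n (t / 2).
rewrite -[_ *+ 2]mulr_natr divfK ?pnatr_eq0 // /= subr0 => c.
have := cos2Dsin2 t; have := cos2Dsin2 (t / 2); move: c.
move: (cos (t / 2) ^+ 2) (sin (t / 2)) (cos t) (sin t) => c s a b.
by rewrite expr_div_n; lra.
Qed.

(** Here [acos (cos t)] is |t|; the sign lost by the cosine disappears in the square. *)
Lemma acos_expi (t : R) : - pi < t <= pi ->
  acos (complex.Re (expi t)) ^+ 2 = t ^+ 2.
Proof.
case/andP => t1 t2 /=; case: (leP 0 t) => t0.
  by rewrite cosK // in_itv /= t0.
by rewrite cosKN ?sqrrN // !ltW.
Qed.

End Expi.

(** * Unitary conjugates of diagonal matrices *)

Section ConjDiag.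
Local Open Scope sesquilinear_scope.
Context {C : numClosedFieldType} {N : nat}.
Implicit Types (P X : 'M[C]_N) (d : 'rV[C]_N).

(** For a fixed unitary [P], differences, products and powers of such matrices are computed
    entrywise on [d]. *)
Definition conj_diag P d : 'M[C]_N := P^t* *m diag_mx d *m P.

(** Each entry is a fixed linear form in [d], so convergence of the eigenvalues gives convergence of
    the matrix. *)
Lemma conj_diagE P d i j :
  conj_diag P d i j = \sum_k d 0 k * (P^t* i k * P k j).
Proof.
rewrite /conj_diag mul_mx_diag mxE; apply: eq_bigr => k _.
by rewrite mxE mulrAC mulrC.
Qed.

Lemma conj_diagZ P d (a : C) : a *: conj_diag P d = conj_diag P (a *: d).
Proof.
by rewrite /conj_diag linearZ /= -scalemxAr -scalemxAl.
Qed.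

Lemma conj_diagB P d e : conj_diag P d - conj_diag P e = conj_diag P (d - e).
Proof. by rewrite /conj_diag linearB mulmxBr mulmxBl. Qed.

Lemma conj_diag_const1 P : P \is unitarymx -> conj_diag P (const_mx 1) = 1%:M.
Proof.
by move=> uP; rewrite /conj_diag diag_const_mx mulmx1 -invmx_unitary // mulVmx
  ?unitarymx_unit.
Qed.

Lemma conj_diagM P d e : P \is unitarymx ->
  conj_diag P d *m conj_diag P e = conj_diag P (\row_j (d 0 j * e 0 j)).
Proof.
move=> uP; rewrite /conj_diag !mulmxA mulmxtVK //.
by rewrite -[_ *m diag_mx _ *m diag_mx _]mulmxA mulmx_diag.
Qed.

Lemma conj_diagX P d k : P \is unitarymx ->
  conj_diag P d ^+ k = conj_diag P (\row_j d 0 j ^+ k).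
Proof.
move=> uP; elim: k => [|k IHk].
  rewrite expr0 -[1]idmxE -(conj_diag_const1 uP); congr conj_diag.
  by apply/rowP => j; rewrite !mxE.
rewrite exprSr IHk -mulmxE conj_diagM //; congr conj_diag.
by apply/rowP => j; rewrite !mxE exprSr.
Qed.

Lemma mxtrace_conj_diag P d : P \is unitarymx ->
  \tr (conj_diag P d) = \sum_k d 0 k.
Proof.
move=> uP; rewrite /conj_diag mxtrace_mulC mulmxA (unitarymxP uP) mul1mx.
exact: mxtrace_diag.
Qed.

(** The conjugation is lifted to matrices of polynomials, where the scalar matrix of the
    indeterminate is central and the determinants of [P] and its adjoint cancel. *)
Lemma char_poly_conj_diag P d : P \is unitarymx ->
  char_poly (conj_diag P d) = \prod_k ('X - (d 0 k)%:P).
Proof.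
move=> uP; transitivity (char_poly (diag_mx d)).
  rewrite /char_poly /char_poly_mx.
  have e : map_mx polyC (P^t*) *m map_mx polyC P = 1%:M.
    by rewrite -map_mxM -invmx_unitary // mulVmx ?unitarymx_unit // map_mx1.
  have -> : 'X%:M - map_mx polyC (conj_diag P d) =
      map_mx polyC (P^t*) *m ('X%:M - map_mx polyC (diag_mx d)) *m map_mx polyC P.
    rewrite /conj_diag !map_mxM mulmxBr mulmxBl; congr (_ - _).
    by rewrite scalar_mxC -mulmxA e mulmx1.
  by rewrite !det_mulmx mulrAC -det_mulmx e det1 mul1r.
rewrite char_poly_trig ?diag_mx_is_trig //.
by apply: eq_bigr => k _; rewrite mxE eqxx mulr1n.
Qed.

Lemma eigenvalue_conj_diag P d k : P \is unitarymx ->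
  eigenvalue (conj_diag P d) (d 0 k).
Proof.
move=> uP; rewrite eigenvalue_root_char char_poly_conj_diag //.
by rewrite (bigD1 k) //= rootM root_XsubC eqxx.
Qed.

Lemma conj_diag_unitary P d : P \is unitarymx ->
  (forall k, d 0 k * Num.conj (d 0 k) = 1) -> conj_diag P d \is unitarymx.
Proof.
move=> uP d1; rewrite !mul_unitarymx ?trmxC_unitary //; apply/unitarymxP.
rewrite tr_diag_mx map_diag_mx mulmx_diag -diag_const_mx; congr diag_mx.
by apply/rowP => k; rewrite !mxE.
Qed.

(** The spectral theorem, with the inverse of the unitary written as its adjoint. *)
Lemma hermsymmx_conj_diag X : X \is hermsymmx ->
  exists P d, [/\ P \is unitarymx, forall k, d 0 k \is Num.real
    & X = conj_diag P d].
Proof.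
move=> hX; exists (spectralmx X), (spectral_diag X).
split; first exact: spectral_unitarymx.
  by move=> k; exact: (mxOverP (hermitian_spectral_diag_real hX)).
have /hermitian_normalmx/orthomx_spectralP {1}-> := hX.
by rewrite invmx_unitary ?spectral_unitarymx.
Qed.

End ConjDiag.

(** * Exponentials of self-adjoint matrices and angular eigenvalues *)

Section Angular.
Local Open Scope complex_scope.
Local Open Scope sesquilinear_scope.
Local Open Scope classical_set_scope.
Context {R : realType} {N : nat}.
Implicit Types (X P U : 'M[R[i]]_N) (l lam : 'rV[R]_N).

Lemma expmx_series_conj_diag P (d : 'rV[R[i]]_N) n i j : P \is unitarymx ->
  series (fun k => k`!%:R^-1 *: conj_diag P d ^+ k) n i j =
  \sum_k (\sum_(0 <= m < n) m`!%:R^-1 * d 0 k ^+ m) * (P^t* i k * P k j).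
Proof.
move=> uP; rewrite /series /= summxE.
transitivity (\sum_(0 <= m < n) \sum_k
   m`!%:R^-1 * d 0 k ^+ m * (P^t* i k * P k j)).
  apply: eq_bigr => m _; rewrite (conj_diagX _ _ uP) mxE conj_diagE mulr_sumr.
  by apply: eq_bigr => k _; rewrite mxE !mulrA.
by rewrite exchange_big; apply: eq_bigr => k _; rewrite mulr_suml.
Qed.

Lemma expimx_conj_diag P l : P \is unitarymx ->
  expimx (conj_diag P (map_mx (real_complex R) l)) = conj_diag P (map_mx expi l).
Proof.
move=> uP; rewrite /expimx /expmx conj_diagZ.
(* Uniqueness of limits identifies the [limn] in [expmx] with the limit exhibited below. *)
have hM : hausdorff_space 'M[(R[i])^o]_N by exact: norm_hausdorff.
apply: (cvg_lim hM).
apply: cvg_mx => i j; rewrite conj_diagE.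
(* Each entry of the partial sums is a finite combination of scalar exponential series, one per
   eigenvalue. *)
rewrite (_ : (fun n => _) = (fun n => \sum_k
  (\sum_(0 <= m < n) m`!%:R^-1 * ('i%C * (l 0 k)%:C) ^+ m : R[i]^o)
    * (P^t* i k * P k j))); last first.
  apply/funext => n; rewrite expmx_series_conj_diag //.
  by apply: eq_bigr => k _; rewrite !mxE.
apply: cvg_big => [|k _]; first exact: add_continuous.
by apply: cvgMr_tmp; rewrite mxE; exact: cvg_expi.
Qed.

Lemma expi_unitary (t : R) : expi t * (expi t)^*%C = 1.
Proof.
apply/eqP; rewrite eq_complex /= mulrN opprK -!expr2 cos2Dsin2 eqxx /=.
by rewrite mulrN mulrC addNr.
Qed.

Lemma hermsymmx_real_conj_diag X : X \is hermsymmx ->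
  exists P l, P \is unitarymx /\ X = conj_diag P (map_mx (real_complex R) l).
Proof.
move=> /hermsymmx_conj_diag[P [d [uP d_real ->]]].
exists P, (map_mx (@complex.Re R) d); split; first exact: uP.
by congr conj_diag; apply/rowP => k; rewrite !mxE RRe_real.
Qed.

Lemma expimx_unitary X : X \is hermsymmx -> expimx X \is unitarymx.
Proof.
move=> /hermsymmx_real_conj_diag[P [l [uP ->]]]; rewrite (expimx_conj_diag _ uP).
by apply: (conj_diag_unitary uP) => k; rewrite mxE; exact: expi_unitary.
Qed.

Lemma euclid_norm_sqr n (v : 'rV[R]_n) : euclid_norm v ^+ 2 = \sum_k v 0 k ^+ 2.
Proof. by rewrite sqr_sqrtr ?sumr_ge0 // => k _; exact: sqr_ge0. Qed.

Lemma plaq_action_expimx_conj_diag P l : P \is unitarymx ->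
  plaq_action (expimx (conj_diag P (map_mx (real_complex R) l)))
    <= euclid_norm l ^+ 2.
Proof.
move=> uP; rewrite (expimx_conj_diag _ uP) /plaq_action -(conj_diag_const1 uP).
rewrite conj_diagB /conj_diag HSnorm_mulUr // HSnorm_mulUl ?trmxC_unitary //.
rewrite [leLHS]HSnorm_sqr_sum euclid_norm_sqr.
apply: ler_sum => i _; rewrite (bigD1 i) //= big1 ?addr0 => [|j ji].
  by rewrite !mxE eqxx mulr1n; exact: expi_sub1_le.
by rewrite !mxE eq_sym (negbTE ji) mulr0n /= !expr0n addr0.
Qed.

(** Parseval: orthonormality identifies Tr(X theta_a) with the real coefficient [c 0 a], and
    expanding the second factor of Tr(X X) gives the sum of squares. *)
Lemma euclid_norm_coords theta X : orthonormal_sa_basis theta ->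
  X \is hermsymmx -> (euclid_norm (coords theta X) ^+ 2)%:C = \tr (X *m X).
Proof.
case=> _ theta_on theta_basis /theta_basis[c [Xc _]].
have tr_theta a : \tr (X *m theta a) = (c 0 a)%:C.
  rewrite Xc mulmx_suml raddf_sum (bigD1 a) //= big1 => [|b ba].
    by rewrite addr0 -scalemxAl mxtraceZ theta_on eqxx mulr1.
  by rewrite -scalemxAl mxtraceZ theta_on (negbTE ba) mulr0.
transitivity (\sum_a (c 0 a ^+ 2)%:C).
  rewrite euclid_norm_sqr rmorph_sum; apply: eq_bigr => a _.
  by rewrite mxE tr_theta.
rewrite [Y in _ = \tr (_ *m Y)]Xc mulmx_sumr [RHS]raddf_sum.
by apply: eq_bigr => a _; rewrite -scalemxAr [RHS]mxtraceZ tr_theta rmorphXn.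
Qed.

Lemma euclid_norm_coords_conj_diag theta P l : orthonormal_sa_basis theta ->
  P \is unitarymx -> conj_diag P (map_mx (real_complex R) l) \is hermsymmx ->
  euclid_norm (coords theta (conj_diag P (map_mx (real_complex R) l))) ^+ 2
    = euclid_norm l ^+ 2.
Proof.
move=> htheta uP hX; apply: complexI; rewrite euclid_norm_coords //.
rewrite (conj_diagM _ _ uP) (mxtrace_conj_diag _ uP) euclid_norm_sqr rmorph_sum /=.
by apply: eq_bigr => k _; rewrite !mxE rmorphXn.
Qed.

Lemma plaq_action_expimx theta X : orthonormal_sa_basis theta ->
  X \is hermsymmx -> plaq_action (expimx X) <= euclid_norm (coords theta X) ^+ 2.
Proof.
move=> htheta hX; have [P [l [uP e]]] := hermsymmx_real_conj_diag hX.
by rewrite e euclid_norm_coords_conj_diag -?e // e plaq_action_expimx_conj_diag.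
Qed.

(* On ]-pi, pi] the square of an angle is a function of its cosine, so equality
   of the multisets of eigenvalues suffices. *)
Lemma euclid_norm_angular theta X lam : orthonormal_sa_basis theta ->
  X \is hermsymmx -> eigenvalues_in_range X ->
  angular_eigenvalues (expimx X) lam ->
  euclid_norm (coords theta X) ^+ 2 = euclid_norm lam ^+ 2.
Proof.
move=> htheta hX; have [P [l [uP e]]] := hermsymmx_real_conj_diag hX.
rewrite {}e in hX * => X_range [lam_range].
rewrite (expimx_conj_diag _ uP) (char_poly_conj_diag _ uP) => eq_char.
rewrite euclid_norm_coords_conj_diag // !euclid_norm_sqr.
have l_range k : - pi < l 0 k <= pi.
  have := X_range _ (eigenvalue_conj_diag _ k uP).
  by rewrite mxE -rmorphN /= ltcR lecR.
under eq_bigr do rewrite -acos_expi //.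
under [RHS]eq_bigr do rewrite -acos_expi //.
pose s (v : 'rV[R]_N) := [seq expi (v 0 k) | k <- index_enum 'I_N].
have sE (v : 'rV[R]_N) : \sum_k acos (complex.Re (expi (v 0 k))) ^+ 2 =
    \sum_(z <- s v) acos (complex.Re z) ^+ 2.
  by rewrite big_map.
(* Equal products of linear factors have the same roots up to order, so the phases of [l] and [lam]
   are permutations of each other. *)
rewrite !sE; apply: perm_big; apply: prod_XsubC_eq.
rewrite !big_map -eq_char.
by apply: eq_bigr => k _; rewrite mxE.
Qed.

End Angular.

(** * Products of four unitaries *)

Lemma prod_nth4 (T : pzRingType) (a b c d : T) :
  \prod_(i < 4) nth 1 [:: a; b; c; d] i = a * b * c * d.
Proof. by rewrite !big_ord_recl big_ord0 /= mulr1 !mulrA. Qed.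

Lemma sum_nth4 (T : Type) (V : nmodType) (g : T -> V) (x0 a b c d : T) :
  \sum_(i < 4) g (nth x0 [:: a; b; c; d] i) = g a + g b + g c + g d.
Proof. by rewrite !big_ord_recl big_ord0 /= addr0 !addrA. Qed.

(** Identity factors may be counted too, since their action vanishes; so a single factor 4 serves
    every plaquette of the total action. *)
Lemma plaq_action_mul4 (R : realType) (N : nat) (U1 U2 U3 U4 : 'M[R[i]]_N) :
  U1 \is unitarymx -> U2 \is unitarymx -> U3 \is unitarymx -> U4 \is unitarymx ->
  plaq_action (U1 *m U2 *m U3 *m U4) <= 4 * N%:R *
    (plaq_action U1 + plaq_action U2 + plaq_action U3 + plaq_action U4).
Proof.
move=> u1 u2 u3 u4; pose F (i : 'I_4) := nth 1 [:: U1; U2; U3; U4] i.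
have uF i : F i \is unitarymx.
  case: i => -[|[|[|[|k]]]] lt_i4; last by exfalso.
  - exact: u1.
  - exact: u2.
  - exact: u3.
  - exact: u4.
have := @plaq_action_prod R N 4 [set: 'I_4] F uF.
rewrite (eq_bigl xpredT (fun i => plaq_action (F i)) (@finset.in_setT _)).
have -> : \prod_i F i = U1 *m U2 *m U3 *m U4 by exact: prod_nth4.
have -> : \sum_i plaq_action (F i) = plaq_action U1 + plaq_action U2
    + plaq_action U3 + plaq_action U4 by exact: sum_nth4.
rewrite finset.cardsT card_ord; apply=> i.
by rewrite finset.in_setT.
Qed.

(** * Incidences between plaquettes and bonds *)

Section Counting.
Context {d L : nat}.
Implicit Types (x : site d L) (b : bond d L) (p : plaquette d L).

(** Periodic translation permutes the sites, so sums over translated sites can be reindexed. *)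
Lemma step_inj (mu : 'I_d) : injective (fun x => step x mu).
Proof.
move=> x y /ffunP e; apply/ffunP => nu; have := e nu; rewrite !ffunE.
by case: eqP => // _; exact: ordS_inj.
Qed.

(** A step in one direction keeps the other coordinate, so the far sides of a free plaquette are
    free as well. *)
Lemma plaq_bonds_in B x (mu nu : 'I_d) : plaq_in B (x, (mu, nu)) ->
  [/\ bond_in B (x, mu), bond_in B (step x mu, nu),
      bond_in B (step x nu, mu) & bond_in B (x, nu)].
Proof.
case/andP => /= mn; case: B => // /andP[/= xm xn].
have nm : nu != mu by rewrite eq_sym neq_ltn mn.
by split; rewrite //= /free_bond /= ffunE ?(negbTE nm) // eq_sym (negbTE nm).
Qed.

Lemma sum_ltn_pairs (R : pzRingType) (g : 'I_d -> R) :
  \sum_(q : 'I_d * 'I_d | (q.1 < q.2)%N) (g q.1 + g q.2)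
    = (d%:R - 1) * \sum_mu g mu.
Proof.
rewrite big_split /= !(big_mkcond (fun q : 'I_d * 'I_d => (q.1 < q.2)%N)) /=.
rewrite -(pair_bigA _ (fun m n : 'I_d => if (m < n)%N then g m else 0)) /=.
rewrite -(pair_bigA _ (fun m n : 'I_d => if (m < n)%N then g n else 0)) /=.
rewrite [X in _ + X]exchange_big -big_split mulr_sumr; apply: eq_bigr => mu _ /=.
(* The direction [mu] itself shows 0 < d, so d - 1 is the number of directions other than [mu], each
   forming one ordered pair with it. *)
rewrite -big_split /= -(natrB _ (leq_ltn_trans (leq0n mu) (ltn_ord mu))) subn1.
rewrite mulr_natl -[d in d.-1]card_ord -(cardC1 mu) -sumr_const [RHS]big_mkcond /=.
apply: eq_bigr => nu _; rewrite !inE -(inj_eq val_inj) /=.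
by case: ltngtP; rewrite ?addr0 ?add0r.
Qed.

(* Counting (plaquette, side) incidences keeps the bound valid for [L = 1],
   where opposite sides of a periodic plaquette coincide. *)
Lemma sum_plaq_bonds_le (R : numDomainType) B (f : bond d L -> R) :
  (forall b, 0 <= f b) ->
  \sum_(p : plaquette d L | plaq_in B p)
     (f (p.1, p.2.1) + f (step p.1 p.2.1, p.2.2)
      + f (step p.1 p.2.2, p.2.1) + f (p.1, p.2.2))
    <= 2 * (d%:R - 1) * \sum_b f b.
Proof.
move=> f_ge0; pose g mu := \sum_x f (x, mu).
have gE mu nu : \sum_x f (step x nu, mu) = g mu.
  by rewrite /g [RHS](reindex_inj (@step_inj nu)).
have -> : \sum_b f b = \sum_mu g mu.
  by rewrite exchange_big pair_bigA; apply: eq_bigr => -[].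
rewrite -mulrA -sum_ltn_pairs mulr_sumr.
(* For free boundary conditions the sum is enlarged to all periodic plaquettes, at no loss since [f]
   is nonnegative. *)
apply: le_trans (_ : \sum_(p : plaquette d L | (p.2.1 < p.2.2)%N)
     (f (p.1, p.2.1) + f (step p.1 p.2.1, p.2.2)
      + f (step p.1 p.2.2, p.2.1) + f (p.1, p.2.2)) <= _).
  rewrite big_mkcond [leRHS]big_mkcond; apply: ler_sum => p _.
  by rewrite /plaq_in; case: ltnP => _ //=; case: ifP => // _; rewrite !addr_ge0.
rewrite big_mkcond /= -(pair_bigA _ (fun (x : site d L) (q : 'I_d * 'I_d) =>
  if (q.1 < q.2)%N then f (x, q.1) + f (step x q.1, q.2)
    + f (step x q.2, q.1) + f (x, q.2) else 0)) /=.
rewrite exchange_big [leRHS]big_mkcond; apply: ler_sum => -[mu nu] _ /=.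
case: ifP => _; last by rewrite big1.
(* Two parallel sides per direction: the plaquettes in the plane (mu, nu) contribute 2 (g mu + g
   nu). *)
by rewrite !big_split /= !gE -/(g mu) -/(g nu) mulr_natl mulr2n addrA.
Qed.

End Counting.

(** * Action bounds in terms of the coordinates *)

Section Bounds.
Context {R : realType} {N : nat} (theta : 'I_(N ^ 2) -> 'M[R[i]]_N)
  (htheta : orthonormal_sa_basis theta).

Lemma plaq_action_prod_expimx n (S : {set 'I_n}) (X : 'I_n -> 'M[R[i]]_N) :
  (forall j, j \in S -> X j \is hermsymmx) ->
  plaq_action (\prod_j (if j \in S then expimx (X j) else 1%:M))
    <= #|S|%:R * N%:R * \sum_(j in S) euclid_norm (coords theta (X j)) ^+ 2.
Proof.
move=> hX; apply: le_trans (plaq_action_prod (A := S) _ _) _.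
- move=> j; case: ifP => [/hX|_]; [exact: expimx_unitary|exact: unitarymx1].
- by move=> j /negbTE ->.
apply: ler_wpM2l; first exact: mulr_ge0 (ler0n _ _) (ler0n _ _).
by apply: ler_sum => j jS; rewrite jS; exact: plaq_action_expimx htheta (hX j jS).
Qed.

Lemma total_action_le d L B (U X : bond d L -> 'M[R[i]]_N) :
  (forall b, bond_in B b -> U b \is unitarymx) ->
  (forall b, gauge_fixed b -> U b = 1%:M) ->
  (forall b, retained B b -> X b \is hermsymmx) ->
  (forall b, retained B b -> U b = expimx (X b)) ->
  total_action B U <= 2 * (d%:R - 1) * (4 * N%:R) *
    \sum_(b : bond d L | retained B b) euclid_norm (coords theta (X b)) ^+ 2.
Proof.
move=> uU gU hX UX.
(* Extension by zero outside the lattice's bonds, so that the counting over all periodic bonds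
   applies. *)
pose f b := if bond_in B b then plaq_action (U b) else 0.
have f_ge0 b : 0 <= f b.
  by rewrite /f; case: ifP => // _; exact: plaq_action_ge0.
have fE b : bond_in B b -> plaq_action (U b) = f b by rewrite /f => ->.
have f_le : \sum_b f b <=
    \sum_(b : bond d L | retained B b) euclid_norm (coords theta (X b)) ^+ 2.
  rewrite [leRHS]big_mkcond; apply: ler_sum => b _; rewrite /f.
  case: ifP => b_in; last by rewrite /retained b_in.
  case: ifPn => [b_ret|].
    by rewrite (UX b b_ret); exact: plaq_action_expimx htheta (hX b b_ret).
  (* A bond of the lattice that is not retained is gauge fixed and has zero action. *)
  by rewrite /retained b_in negbK => /gU ->; rewrite plaq_action1.
pose s (p : plaquette d L) := f (p.1, p.2.1) + f (step p.1 p.2.1, p.2.2)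
  + f (step p.1 p.2.2, p.2.1) + f (p.1, p.2.2).
apply: le_trans (_ : 4 * N%:R * \sum_(p | plaq_in B p) s p <= _).
  rewrite mulr_sumr; apply: ler_sum => -[x [mu nu]] p_in.
  have [b1 b2 b3 b4] := plaq_bonds_in p_in.
  rewrite /s /= -(fE _ b1) -(fE _ b2) -(fE _ b3) -(fE _ b4).
  rewrite -(plaq_action_trmxC (U (step x nu, mu))) -(plaq_action_trmxC (U (x, nu))).
  apply: plaq_action_mul4; [exact: uU|exact: uU| |].
    by rewrite trmxC_unitary; exact: uU.
  by rewrite trmxC_unitary; exact: uU.
rewrite [2 * _ * _]mulrC -[leRHS]mulrA.
apply: ler_wpM2l; first exact: mulr_ge0 (ler0n _ _) (ler0n _ _).
apply: le_trans (sum_plaq_bonds_le _ f_ge0) _.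
(* For d = 0 the coefficient d - 1 is negative, but there are no bonds and both sums are empty. *)
case: d => [|d] in U X uU gU hX UX f f_ge0 fE f_le s *.
  by rewrite !big1 // => -[x []].
by apply: ler_wpM2l f_le; rewrite mulr_ge0 // -natrB.
Qed.

End Bounds.

Theorem lemma1 (R : realType) (N : nat) (theta : 'I_(N ^ 2) -> 'M[R[i]]_N)
    (htheta : orthonormal_sa_basis theta)
    (C : R) (hC : C = 2 * Num.sqrt N%:R) :
  (* (1), four retained bond variables *)
  (forall X : 'I_4 -> 'M[R[i]]_N,
     (forall j, X j \is hermsymmx) ->
     (forall j, eigenvalues_in_range (X j)) ->
     plaq_action (\prod_(j < 4) expimx (X j))
       <= C ^+ 2 * \sum_(j < 4) euclid_norm (coords theta (X j)) ^+ 2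
     /\
     forall lam : 'I_4 -> 'rV[R]_N,
       (forall j, angular_eigenvalues (expimx (X j)) (lam j)) ->
       C ^+ 2 * \sum_(j < 4) euclid_norm (coords theta (X j)) ^+ 2
         = C ^+ 2 * \sum_(j < 4) euclid_norm (lam j) ^+ 2)
  /\
  (* (1), m retained bond variables, at the positions in S *)
  (forall (m : nat) (S : {set 'I_4}) (X : 'I_4 -> 'M[R[i]]_N),
     (1 <= m <= 3)%N -> #|S| = m ->
     (forall j, j \in S -> X j \is hermsymmx) ->
     (forall j, j \in S -> eigenvalues_in_range (X j)) ->
     plaq_action (\prod_(j < 4) (if j \in S then expimx (X j) else 1%:M))
       <= m%:R * N%:R * \sum_(j in S) euclid_norm (coords theta (X j)) ^+ 2
     /\
     forall lam : 'I_4 -> 'rV[R]_N,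
       (forall j, j \in S -> angular_eigenvalues (expimx (X j)) (lam j)) ->
       m%:R * N%:R * \sum_(j in S) euclid_norm (coords theta (X j)) ^+ 2
         = m%:R * N%:R * \sum_(j in S) euclid_norm (lam j) ^+ 2)
  /\
  (* (2) *)
  (forall (d L : nat) (B : boundary)
          (U : bond d L -> 'M[R[i]]_N) (X : bond d L -> 'M[R[i]]_N),
     (2 <= d <= 4)%N ->
     (forall b, bond_in B b -> U b \is unitarymx) ->
     (forall b, gauge_fixed b -> U b = 1%:M) ->
     (forall b, retained B b -> X b \is hermsymmx) ->
     (forall b, retained B b -> eigenvalues_in_range (X b)) ->
     (forall b, retained B b -> U b = expimx (X b)) ->
     total_action B U
       <= 2 * (d%:R - 1) * C ^+ 2
          * \sum_(b : bond d L | retained B b)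
              euclid_norm (coords theta (X b)) ^+ 2
     /\
     forall lam : bond d L -> 'rV[R]_N,
       (forall b, retained B b -> angular_eigenvalues (U b) (lam b)) ->
       2 * (d%:R - 1) * C ^+ 2
         * \sum_(b : bond d L | retained B b)
             euclid_norm (coords theta (X b)) ^+ 2
       = 2 * (d%:R - 1) * C ^+ 2
         * \sum_(b : bond d L | retained B b) euclid_norm (lam b) ^+ 2).
Proof.
(* The 4 here matches the number of sides in the plaquette bound. *)
have C2 : C ^+ 2 = 4 * N%:R.
  by rewrite hC exprMn sqr_sqrtr ?ler0n // -natrX.
split; [|split].
- move=> X hX X_range; split=> [|lam hlam].
    have := @plaq_action_prod_expimx R N theta htheta 4 [set: 'I_4] X.
    rewrite finset.cardsT card_ord C2 => /(_ (fun j _ => hX j)).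
    rewrite (eq_bigr (fun j => expimx (X j))) => [|j _]; last by rewrite finset.in_setT.
    by rewrite [X in _ <= _ * X -> _](eq_bigl xpredT) => [|j]; rewrite ?finset.in_setT.
  by congr (_ * _); apply: eq_bigr => j _; exact: euclid_norm_angular.
- move=> m S X _ <- hX X_range; split=> [|lam hlam].
    exact: plaq_action_prod_expimx.
  congr (_ * _); apply: eq_bigr => j jS.
  exact: euclid_norm_angular htheta (hX j jS) (X_range j jS) (hlam j jS).
move=> d L B U X _ uU gU hX X_range UX; split=> [|lam hlam].
  by rewrite C2; exact: total_action_le.
congr (_ * _); apply: eq_bigr => b b_ret.
apply: euclid_norm_angular htheta (hX b b_ret) (X_range b b_ret) _.
by rewrite -UX //; exact: hlam.
Qed.
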